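(* Let $k \ge 3$ be an integer and let $G$ be a finite simple undirected connected graph on $n \ge 2$ vertices. Let $\mu_2$ and $\mu_n$ denote the second smallest and the largest eigenvalue of the Laplacian matrix of $G$, respectively. If $(k-1)\mu_2 \ge \mu_n$, then $G$ has a spanning tree with maximum degree at most $k$.
   Context: The Laplacian matrix of a graph $G$ is $L = D - A$, where $D$ is the diagonal matrix of vertex degrees and $A$ is the adjacency matrix. The eigenvalues of $L$ are listed with multiplicity in nondecreasing order $0=\mu_1 \le \mu_2 \le \cdots \le \mu_n$. *)

(* Defs.v *)
From mathcomp Require Import all_boot all_order all_algebra.

Set Implicit Arguments.
Unset Strict Implicit.
Unset Printing Implicit Defensive.

Import Order.TTheory GRing.Theory Num.Theory.
Local Open Scope ring_scope.

Definition simple_graph (T : finType) (e : rel T) : Prop :=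
  symmetric e /\ irreflexive e.

Definition connected_graph (T : finType) (e : rel T) : Prop :=
  forall x y : T, connect e x y.

Definition degree (T : finType) (e : rel T) (x : T) : nat :=
  #|[set y | e x y]|.

Definition max_degree (T : finType) (e : rel T) : nat :=
  (\max_(x : T) degree e x)%N.

(* Since e is symmetric, a single edge [:: x; y] already satisfies [ucycle];
   the graph-theoretic cycles are those of size at least 3. *)
Definition acyclic_graph (T : finType) (e : rel T) : Prop :=
  forall c : seq T, ucycle e c -> (size c < 3)%N.

(* For an empty T this holds vacuously; it is meant for nonempty T. *)
Definition tree (T : finType) (t : rel T) : Prop :=
  [/\ simple_graph t, connected_graph t & acyclic_graph t].

(* t lives on the same vertex type as e, so it is automatically spanning. *)
Definition spanning_tree (T : finType) (e t : rel T) : Prop :=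
  tree t /\ subrel t e.

Definition adjacency (R : pzRingType) (T : finType) (e : rel T) : 'M[R]_#|T| :=
  \matrix_(i, j) (e (enum_val i) (enum_val j))%:R.

Definition degree_matrix (R : pzRingType) (T : finType) (e : rel T) :
    'M[R]_#|T| :=
  diag_mx (\row_i (degree e (enum_val i))%:R).

Definition laplacian (R : pzRingType) (T : finType) (e : rel T) : 'M[R]_#|T| :=
  degree_matrix R e - adjacency R e.

(* mu lists the eigenvalues of A with (algebraic) multiplicity in nondecreasing
   order; this determines mu and forces size mu = n, and such a mu exists when A
   is symmetric (spectral theorem).  Indexing starts at 0:
   the i-th smallest eigenvalue is mu`_(i.-1). *)
Definition is_spectrum (R : rcfType) (n : nat) (A : 'M[R]_n) (mu : seq R) :
    Prop :=
  sorted <=%R mu /\ char_poly A = \prod_(z <- mu) ('X - z%:P).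

(* Main.v *)
Require Import Defs.
From mathcomp Require Import all_boot all_order all_algebra.
From mathcomp Require Import perm complex spectral sesquilinear.
From mathcomp Require Import zify ring.

Set Implicit Arguments.
Unset Strict Implicit.
Unset Printing Implicit Defensive.

Import Order.TTheory GRing.Theory Num.Theory.

(** The theorem combines a spectral bound on the number of components left by
    the deletion of a vertex set with an exchange argument on spanning trees.

    Spectral part.  Let n = #|T|.  The vector n 1_C - |C| 1 is orthogonal to
    the all-ones kernel vector of the Laplacian, has squared norm
    n |C| (n - |C|), and its Laplacian form is n^2 times the number of edges
    leaving C.  Rayleigh quotients hence put n * cut C between mu_2 and mu_n
    times |C| (n - |C|) ([cut_ge_second], [cut_le_max]).  Let c be the number
    of components of G - S.  Summing the lower bound over the components and
    comparing with the upper bound for their union, which cuts the same edges,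
    gives mu_2 (|S| + c - 1) <= mu_n |S|, because the complement of each
    component has at least |S| + c - 1 vertices.  With (k-1) mu_2 >= mu_n this
    becomes c <= (k-2) |S| + 1 ([parts_bound]).

    Combinatorial part.  A connected graph with that property has a spanning
    tree of maximum degree at most k ([bounded_degree_spanning_tree]), a
    version of a theorem of Win, by local search in the manner of Fürer and
    Raghavachari.  Suppose that the tree E0 has a vertex of degree above k.
    Consider sets S that contain all such vertices and for which every vertex
    outside S can be brought below degree k by changing E0 only inside the
    components of E0 - S.  The whole vertex set is one; take a minimal one.
    - All vertices of S have degree at least k: another one could be dropped.
    - If an edge uv of G joins two components of E0 - S, first bring u and v
      below degree k, independently, as their components differ; then add uv
      and remove an edge at some vertex w of S on the cycle so created.  If w
      had degree above k, this lowers the total excess over k, and the search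
      goes on from a better tree.  Otherwise every vertex of S on the cycle can
      be brought below k in this way, so they can all be dropped from S.
    - If there is no such edge, the components of E0 - S are those of G - S.
      Deleting S from a tree leaves at least 2 + sum_S (d - 2) components
      ([sum_degree_le]), more than (k-2) |S| + 1 here: a contradiction. *)

(** * Forests as symmetric arc sets *)
Section Forests.
Variable T : finType.
Implicit Types (E F : {set T * T}) (S : {set T}).

(** Graphs that get modified are handled as symmetric sets of arcs.  Each edge
    then counts twice, and the number of arcs is the sum of the degrees. *)
Definition arc_rel E : rel T := [rel x y | (x, y) \in E].
Definition comps E : nat := #|fingraph.roots (arc_rel E)|.
Local Notation rep E := (fingraph.root (arc_rel E)).
Definition edge (u v : T) : {set T * T} := [set (u, v); (v, u)].
Definition loopless E := forall x, (x, x) \notin E.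

Lemma connect_arcs_sub E F :
  E \subset F -> subrel (connect (arc_rel E)) (connect (arc_rel F)).
Proof.
by move/subsetP=> EF; apply: connect_sub => x y /EF; apply: connect1.
Qed.

Lemma in_edge u v x y :
  ((x, y) \in edge u v) = ((x == u) && (y == v)) || ((x == v) && (y == u)).
Proof. by rewrite !inE !xpair_eqE. Qed.

Lemma edge_sym u v : symmetric (arc_rel (edge u v)).
Proof.
by move=> x y; rewrite /arc_rel /= !in_edge orbC andbC [X in _ || X]andbC.
Qed.

Lemma card_edge u v : u != v -> #|edge u v| = 2.
Proof. by move=> ne; rewrite cards2 xpair_eqE (negPf ne). Qed.

Lemma arcsU_sym E F : symmetric (arc_rel E) -> symmetric (arc_rel F) ->
  symmetric (arc_rel (E :|: F)).
Proof.
move=> sE sF x y; rewrite /arc_rel /= !inE.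
by congr (_ || _); [apply: sE | apply: sF].
Qed.

Lemma arcsD_sym E F : symmetric (arc_rel E) -> symmetric (arc_rel F) ->
  symmetric (arc_rel (E :\: F)).
Proof.
move=> sE sF x y; rewrite /arc_rel /= !inE.
by congr (~~ _ && _); [apply: sF | apply: sE].
Qed.

(** A walk that uses the new edge has visited u or v before. *)
Lemma connect_add_edge E u v x y : symmetric (arc_rel E) ->
  connect (arc_rel (E :|: edge u v)) x y ->
  ~~ connect (arc_rel E) u x -> ~~ connect (arc_rel E) v x ->
  connect (arc_rel E) x y.
Proof.
move=> symE /connectP[p]; elim: p x => [|z p IHp] x /= => [_ -> //|].
case/andP=> xz pth ylast ux vx.
have csym := sym_connect_sym symE.
have Exz : arc_rel E x z.
  move: xz; rewrite /arc_rel /= in_setU in_edge.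
  case/or3P => // /andP[/eqP xe _].
    by rewrite xe connect0 in ux.
  by rewrite xe connect0 in vx.
apply: connect_trans (connect1 Exz) _; apply: IHp => //.
  by rewrite -(same_connect_r csym (connect1 Exz)).
by rewrite -(same_connect_r csym (connect1 Exz)).
Qed.

(** A new edge merges at most two components: the representatives of all
    components but that of v stay in distinct components. *)
Lemma comps_add_edge E u v : symmetric (arc_rel E) ->
  comps E <= (comps (E :|: edge u v)).+1.
Proof.
move=> symE; have symE' := arcsU_sym symE (edge_sym u v).
set E' := E :|: _ in symE' *; have csym := sym_connect_sym symE.
have csym' := sym_connect_sym symE'.
rewrite /comps (cardD1 (rep E v)).
have -> : rep E v \in fingraph.roots (arc_rel E) by rewrite inE roots_root.
rewrite add1n ltnS.
set D := [predD1 _ & _].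
rewrite -(card_in_image (f := rep E') (A := D)).
  apply: subset_leq_card; apply/subsetP => _ /imageP[x _ ->].
  by rewrite inE roots_root.
move=> x y; rewrite !inE => /andP[xv /eqP rx] /andP[yv /eqP ry].
move/(fingraph.rootP csym') => xy.
have far z : rep E z = z -> z != rep E v ->
    ~~ connect (arc_rel E) v z.
  by move=> rz; apply: contra => /(fingraph.rootP csym) ->; rewrite rz.
suff : connect (arc_rel E) x y by move/(fingraph.rootP csym); rewrite rx ry.
have [ux|ux] := boolP (connect (arc_rel E) u x); last first.
  exact: connect_add_edge symE xy ux (far _ rx xv).
have [uy|uy] := boolP (connect (arc_rel E) u y).
  by rewrite -(same_connect csym ux).
rewrite csym' in xy.
by rewrite csym; apply: (connect_add_edge symE xy uy (far _ ry yv)).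
Qed.

(** Mapping the components of F to components of E that they contain is
    injective and cannot reach both that of u and that of v. *)
Lemma comps_lt E F u v : symmetric (arc_rel E) -> symmetric (arc_rel F) ->
  E \subset F -> connect (arc_rel F) u v -> ~~ connect (arc_rel E) u v ->
  comps F < comps E.
Proof.
move=> symE symF EF Fuv nEuv.
have csym := sym_connect_sym symE; have csymF := sym_connect_sym symF.
have inj : {in fingraph.roots (arc_rel F) &, injective (rep E)}.
  move=> x y; rewrite !inE => /eqP rx /eqP ry.
  move/(fingraph.rootP csym)/(connect_arcs_sub EF)/(fingraph.rootP csymF).
  by rewrite rx ry.
rewrite /comps -(card_in_image inj); apply: proper_card.
apply/properP; split.
  by apply/subsetP => _ /imageP[x _ ->]; rewrite inE roots_root.
have rE x : rep E x \in fingraph.roots (arc_rel E) by rewrite inE roots_root.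
set im := [seq rep E x | x in fingraph.roots (arc_rel F)].
have [/imageP[a ra ua]|nu] := boolP (rep E u \in im);
  last by exists (rep E u).
have [/imageP[b rb vb]|nv] := boolP (rep E v \in im);
  last by exists (rep E v).
case/negP: nEuv; apply/(fingraph.rootP csym); rewrite ua vb.
congr (fingraph.root _ _).
move: ra rb; rewrite !inE => /eqP <- /eqP <-; apply/(fingraph.rootP csymF).
have ua' : connect (arc_rel F) u a.
  by apply: (connect_arcs_sub EF); apply/(fingraph.rootP csym).
have vb' : connect (arc_rel F) v b.
  by apply: (connect_arcs_sub EF); apply/(fingraph.rootP csym).
by rewrite csymF in ua'; apply: connect_trans ua' (connect_trans Fuv vb').
Qed.

(** Half of the potential is #|T| plus the cyclomatic number, so the forests
    are the graphs of potential 2 * #|T|. *)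
Definition potential E := 2 * comps E + #|E|.

(** Each further edge adds two arcs and removes at most one component. *)
Lemma potential_mono E F : symmetric (arc_rel E) -> symmetric (arc_rel F) ->
  loopless F -> E \subset F -> potential E <= potential F.
Proof.
have [m] := ubnP #|F :\: E|; elim: m E => // m IHm E lt_m symE symF irrF EF.
have [FE|[[u v]]] := set_0Vmem (F :\: E).
  suff -> : E = F by [].
  by apply/eqP; rewrite eqEsubset EF -setD_eq0 FE eqxx.
rewrite inE => /andP[nEuv Fuv].
have uv : u != v by apply: contraTneq Fuv => ->; apply: irrF.
have nEvu : (v, u) \notin E by have := symE u v; rewrite /arc_rel /= => <-.
have Fvu : (v, u) \in F by have := symF u v; rewrite /arc_rel /= => <-.
have dis : [disjoint E & edge u v].
  rewrite disjoint_sym disjoint_subset; apply/subsetP => p; rewrite !inE.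
  by case/orP=> /eqP ->.
apply: (@leq_trans (potential (E :|: edge u v))).
  have := comps_add_edge u v symE.
  rewrite /potential cardsU (disjoint_setI0 dis) cards0 card_edge //; lia.
apply: IHm => //.
- rewrite -ltnS; apply: leq_trans lt_m; rewrite ltnS; apply: proper_card.
  apply/properP; split.
    by apply: setDS; apply: subsetUl.
  by exists (u, v); rewrite !inE ?eqxx ?orbT //= Fuv nEuv.
- by apply: arcsU_sym (edge_sym u v).
- rewrite subUset EF; apply/subsetP => p; rewrite !inE.
  by case/orP=> /eqP ->.
Qed.

Lemma comps0 : comps set0 = #|T|.
Proof.
apply: eq_card => x; rewrite !inE; apply/eqP.
case/connectP: (connect_root (arc_rel set0) x) => [[|y p]] //=.
by rewrite /arc_rel /= inE.
Qed.

(** Among connected graphs the trees are those with at most #|T| - 1 edges.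
    The count takes the place of acyclicity because it is easy to follow
    through the replacement of edges. *)
Definition treelike E :=
  [/\ symmetric (arc_rel E), loopless E, forall x y, connect (arc_rel E) x y
    & #|E| + 2 <= 2 * #|T|].

Lemma comps_connected E (x0 : T) :
  (forall x y, connect (arc_rel E) x y) -> symmetric (arc_rel E) -> comps E = 1.
Proof.
move=> conE symE; have csym := sym_connect_sym symE.
rewrite /comps -(card1 (rep E x0)); apply: eq_card => x.
rewrite !inE; apply/eqP/eqP => [<-|->]; last exact: root_root.
exact/(fingraph.rootP csym).
Qed.

Lemma potential0 : potential set0 = 2 * #|T|.
Proof. by rewrite /potential comps0 cards0 addn0. Qed.

Lemma arcs0_sym : symmetric (arc_rel set0).
Proof. by move=> x y; rewrite /arc_rel /= !inE. Qed.

Lemma connected_card_ge E (x0 : T) :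
  symmetric (arc_rel E) -> loopless E ->
  (forall x y, connect (arc_rel E) x y) ->
  2 * #|T| <= #|E| + 2.
Proof.
move=> symE irrE conE; rewrite -potential0 addnC.
have := potential_mono arcs0_sym symE irrE (sub0set E).
by rewrite [potential E]/potential (comps_connected x0).
Qed.

(** Subgraphs of a tree are forests: their potential lies between that of the
    empty graph and that of the tree. *)
Lemma subforest_potential E F (x0 : T) :
  treelike F -> symmetric (arc_rel E) -> E \subset F -> potential E = 2 * #|T|.
Proof.
case=> symF irrF conF cardF symE EF; apply/eqP; rewrite eqn_leq.
apply/andP; split.
  apply: leq_trans (potential_mono symE symF irrF EF) _.
  by rewrite /potential (comps_connected x0) // addnC.
rewrite -potential0; apply: potential_mono => //; first exact: arcs0_sym.
  by move=> x; apply: contra (irrF x); apply/subsetP.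
exact: sub0set.
Qed.

Definition avoid S E : {set T * T} :=
  [set p in E | (p.1 \notin S) && (p.2 \notin S)].

Lemma in_avoid S E x y :
  arc_rel (avoid S E) x y = [&& arc_rel E x y, x \notin S & y \notin S].
Proof. by rewrite /arc_rel /= inE. Qed.

Lemma avoid_sub S E : avoid S E \subset E.
Proof. by apply/subsetP => p; rewrite inE => /andP[]. Qed.

Lemma avoid_sym S E : symmetric (arc_rel E) -> symmetric (arc_rel (avoid S E)).
Proof.
move=> symE x y; rewrite !in_avoid; congr andb; first exact: symE.
by rewrite andbC.
Qed.

Lemma sum_degree E (A : {set T}) :
  \sum_(x in A) degree (arc_rel E) x = #|[set p in E | p.1 \in A]|.
Proof.
rewrite -sum1_card.
under eq_bigr => x _ do rewrite /degree -sum1_card.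
rewrite pair_big_dep /=; apply: eq_bigl => -[x y].
by rewrite !inE /arc_rel /= andbC.
Qed.

(** The vertices outside S are isolated, and S contributes one more
    component. *)
Lemma comps_inside S E : S != set0 -> symmetric (arc_rel E) ->
  (forall x y, (x, y) \in E -> (x \in S) && (y \in S)) ->
  #|T| < comps E + #|S|.
Proof.
case/set0Pn=> s Ss symE inS; have csym := sym_connect_sym symE.
have clS : closed (arc_rel E) S by move=> x y /inS/andP[-> ->].
have : [set x | (x \notin S) || (x == rep E s)]
   \subset fingraph.roots (arc_rel E).
  apply/subsetP => x; rewrite !inE => /orP[xS|/eqP ->]; last exact: roots_root.
  apply/eqP; case/connectP: (connect_root (arc_rel E) x) => [[|y p]] //=.
  by case/andP=> /inS/andP[Sx _]; rewrite Sx in xS.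
move/subset_leq_card => le_roots.
rewrite -(cardsC S) addnC ltn_add2r; apply: leq_trans le_roots.
have -> : [set x | (x \notin S) || (x == rep E s)]
    = rep E s |: ~: S by apply/setP => x; rewrite !inE orbC.
rewrite cardsU1 inE negbK.
by rewrite -(closed_connect clS (connect_root (arc_rel E) s)) Ss.
Qed.

(** Deleting S from a tree leaves at least 2 + sum_S (d - 2) components; in
    [comps (avoid S E)] the vertices of S count as #|S| further isolated ones.
    The edges inside S form a forest on S, so at most #|S| - 1 edges are
    counted twice in the sum of the degrees.  This bounds from above the number
    of edges off S, and in a forest fewer edges mean more components. *)
Lemma sum_degree_le S E : treelike E -> S != set0 ->
  \sum_(x in S) degree (arc_rel E) x + 2 <= #|S| + comps (avoid S E).
Proof.
move=> treeE nzS; have [symE irrE conE cardE] := treeE.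
have [s _] := set0Pn _ nzS.
pose F2 := [set p in E | (p.1 \in S) && (p.2 \in S)].
have symF2 : symmetric (arc_rel F2).
  move=> x y; rewrite /arc_rel /= !inE /=; congr andb; first exact: symE.
  by rewrite andbC.
have pF1 := subforest_potential s treeE (avoid_sym S symE) (avoid_sub S E).
have pF2 : potential F2 = 2 * #|T|.
  apply: (subforest_potential s treeE symF2).
  by apply/subsetP => p; rewrite inE => /andP[].
have cF2 : #|T| < comps F2 + #|S|.
  by apply: comps_inside => // x y; rewrite inE => /andP[].
pose out := [set p in E | (p.1 \in S) && (p.2 \notin S)].
pose inw := [set p in E | (p.1 \notin S) && (p.2 \in S)].
have eq_io : #|out| = #|inw|.
  have inj_swap : injective (fun p : T * T => (p.2, p.1)).
    by case=> a b [c d] [-> ->].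
  rewrite -(card_imset _ inj_swap); apply: eq_card => -[x y].
  apply/imsetP/idP => [[[a b]] | ].
    rewrite !inE /= => /and3P[Eab aS bS] [-> ->].
    by have := symE a b; rewrite /arc_rel /= => <-; rewrite Eab aS bS.
  rewrite inE /= => /and3P[Exy xS yS]; exists (y, x) => //.
  by have := symE x y; rewrite /arc_rel !inE /= => <-; rewrite Exy xS yS.
have card_split (A B : {set T * T}) : #|A| = #|A :&: B| + #|A :\: B|.
  by rewrite cardsID.
have splitS : #|[set p in E | p.1 \in S]| = #|F2| + #|out|.
  rewrite (card_split _ [set p | p.2 \in S]); congr (_ + _);
    apply: eq_card => p; rewrite !inE;
    by case: (p \in E); case: (p.1 \in S); case: (p.2 \in S).
have splitE : #|E| = #|[set p in E | p.1 \in S]| + (#|inw| + #|avoid S E|).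
  rewrite (card_split E [set p | p.1 \in S]); congr (_ + _).
    by apply: eq_card => p; rewrite !inE.
  rewrite (card_split _ [set p | p.2 \in S]); congr (_ + _);
    apply: eq_card => p; rewrite !inE;
    by case: (p \in E); case: (p.1 \in S); case: (p.2 \in S).
rewrite sum_degree; move: pF1 pF2; rewrite /potential.
lia.
Qed.

(** A subforest with as many arcs as possible is connected, as otherwise an
    edge of the graph between two of its components could be added. *)
Lemma treelike_exists (e : rel T) (x0 : T) :
  simple_graph e -> connected_graph e ->
  exists2 E, treelike E & subrel (arc_rel E) e.
Proof.
case=> sym_e irr_e con_e.
pose P E := [&& [forall x, forall y, arc_rel E x y == arc_rel E y x],
                [forall x, forall y, arc_rel E x y ==> e x y]
              & potential E <= 2 * #|T|].
have P0 : P set0.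
  rewrite /P potential0 leqnn andbT; apply/andP; split.
    by apply/forallP => x; apply/forallP => y; rewrite (arcs0_sym x y).
  by apply/forallP => x; apply/forallP => y; rewrite /arc_rel /= inE.
case: (arg_maxnP (fun E => #|E|) P0) => E /and3P[symb subb potE] maxE.
have symE : symmetric (arc_rel E).
  by move=> x y; have /forallP/(_ x)/forallP/(_ y)/eqP := symb.
have subE : subrel (arc_rel E) e.
  by move=> x y; have /forallP/(_ x)/forallP/(_ y)/implyP := subb.
have irrE : loopless E by move=> x; apply/negP => /subE; rewrite irr_e.
suff conE : forall x y, connect (arc_rel E) x y.
  exists E => //; split=> //; move: potE.
  by rewrite /potential (comps_connected x0) // addnC.
move=> x y; move: (con_e x y); apply: connect_sub => {x y} u v e_uv.
apply: contraT => nuv.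
have nEuv : (u, v) \notin E by apply: contra nuv; apply: connect1.
have nEvu : (v, u) \notin E by have := symE u v; rewrite /arc_rel /= => <-.
have ne_uv : u != v by apply: contraTneq e_uv => ->; rewrite irr_e.
have symE' := arcsU_sym symE (edge_sym u v).
have dis : E :&: edge u v = set0.
  apply/setP => p; rewrite !inE; apply: contraTF isT => /andP[Ep].
  by case/orP=> /eqP pe; rewrite pe in Ep;
    [rewrite Ep in nEuv | rewrite Ep in nEvu].
have cardE' : #|E :|: edge u v| = #|E| + 2.
  by rewrite cardsU dis cards0 subn0 card_edge.
suff /maxE : P (E :|: edge u v) by rewrite cardE'; lia.
apply/and3P; split.
- by apply/forallP => x; apply/forallP => y; rewrite symE'.
- apply/forallP => x; apply/forallP => y; apply/implyP.
  rewrite /arc_rel /= in_setU in_edge => /orP[/subE //|].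
  by case/orP=> /andP[/eqP -> /eqP ->] //; rewrite sym_e.
have lt : comps (E :|: edge u v) < comps E.
  apply: (comps_lt symE symE' (subsetUl _ _) _ nuv).
  by apply: connect1; rewrite /arc_rel /= in_setU in_edge !eqxx orbT.
by move: potE; rewrite /potential cardE'; lia.
Qed.

Lemma cycle_edge_redundant E x y z c : symmetric (arc_rel E) ->
  ucycle (arc_rel E) [:: x, y, z & c] -> connect (arc_rel (E :\: edge x y)) y x.
Proof.
move=> symE /andP[/= /and3P[_ Eyz]]; rewrite rcons_path => /andP[path_c last_x].
rewrite !inE !negb_or => /andP[/and3P[ne_xy ne_xz x_c]].
case/andP=> /andP[ne_yz y_c] uniq_c.
have keep a b : a != x -> b != x -> arc_rel E a b ->
    arc_rel (E :\: edge x y) a b.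
  move=> ax bx; rewrite /arc_rel /= in_setD in_edge => ->.
  by rewrite (negPf ax) (negPf bx) andbF.
apply: (@connect_trans _ _ (last z c)).
  apply/connectP; exists (z :: c) => //.
  apply: (sub_in_path (P := predC1 x) (e := arc_rel E)) => //=.
  - rewrite (eq_sym y) ne_xy (eq_sym z) ne_xz /=; apply/allP => a ca.
    by apply: contraNneq x_c => <-.
  - by rewrite Eyz.
have [lx ly] : last z c != x /\ last z c != y.
  have: last z c \in z :: c := mem_last z c.
  rewrite inE; case/orP => [/eqP ->|lc]; first by rewrite !(eq_sym z).
  by split; [apply: contraNneq x_c | apply: contraNneq y_c] => <-.
apply: connect1; move: last_x; rewrite /arc_rel /= in_setD in_edge => ->.
by rewrite (negPf lx) (negPf ly).
Qed.

(** Without an edge of a cycle the graph would remain connected, with fewer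
    than #|T| - 1 edges. *)
Lemma treelike_tree E : treelike E -> tree (arc_rel E).
Proof.
case=> symE irrE conE cardE; split=> //.
  by split=> // x; apply: negbTE; apply: irrE.
move=> [|x [|y [|z c]]] // cyc; exfalso.
have red := cycle_edge_redundant symE cyc.
have Exy : (x, y) \in E by case/andP: cyc => /andP[].
have Eyx : (y, x) \in E by have := symE x y; rewrite /arc_rel /= => <-.
have ne_xy : x != y by apply: contraTneq Exy => ->; apply: irrE.
have symE' := arcsD_sym symE (edge_sym x y).
have con' a b : connect (arc_rel (E :\: edge x y)) a b.
  apply: connect_sub (conE a b) => {}a {}b Eab.
  have [|nab] := boolP ((a, b) \in edge x y); last first.
    by apply: connect1; rewrite /arc_rel /= in_setD nab.
  rewrite in_edge => /orP[] /andP[/eqP -> /eqP ->] //.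
  by rewrite (sym_connect_sym symE').
have irr' : loopless (E :\: edge x y).
  by move=> a; rewrite inE negb_and (irrE a) orbT.
have := connected_card_ge x symE' irr' con'.
have sub : edge x y \subset E.
  by apply/subsetP => p; rewrite !inE => /orP[]/eqP->.
have := subset_leq_card sub.
rewrite cardsD (setIidPr sub) card_edge //; lia.
Qed.

(** * Improving a tree with a vertex of large degree *)
Lemma connect_within (C : {set T}) (r r' : rel T) x y :
  (forall a b, a \in C -> r a b -> r' a b && (b \in C)) ->
  x \in C -> connect r x y -> connect r' x y.
Proof.
move=> stay xC /connectP[p]; elim: p x xC => [|z p IHp] x xC /= => [_ -> //|].
case/andP=> /(stay _ _ xC)/andP[xz zC] pth ylast.
exact: connect_trans (connect1 xz) (IHp _ zC pth ylast).
Qed.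

(** The edge between w and its predecessor w' on the path from u to v is
    replaced by the rest of the path together with the new edge from u to v;
    the path being simple, the rest of it does not use that edge. *)
Lemma connect_exchange (r r' : rel T) u v w p1 p2 :
  symmetric r' -> let w' := last u p1 in
  path r u (p1 ++ w :: p2) -> uniq (u :: p1 ++ w :: p2) -> v = last w p2 ->
  r' u v ->
  (forall x y, r x y -> (x, y) \notin edge w w' -> r' x y) ->
  subrel (connect r) (connect r').
Proof.
move=> symr' w' path_p; rewrite -cat_cons cat_uniq.
case/and3P=> _ dis _ def_v r'uv keep.
move: path_p; rewrite cat_path /= -/w' => /and3P[path1 _ path2].
have csym := sym_connect_sym symr'.
have w_p1 : w \notin u :: p1.
  by apply: contra dis => wp; apply/hasP; exists w; rewrite ?mem_head.
have w'_p2 : w' \notin w :: p2.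
  by apply: contra dis => wp; apply/hasP; exists w'; rewrite ?mem_last.
have con1 : connect r' u w'.
  apply/connectP; exists p1 => //.
  apply: (sub_in_path (P := predC1 w) (e := r)) path1.
    move=> a b; rewrite !inE => aw bw /keep; apply; rewrite in_edge.
    by rewrite (negPf aw) (negPf bw) andbF.
  by apply/allP => a ap /=; apply: contraNneq w_p1 => <-.
have con2 : connect r' w v.
  apply/connectP; exists p2 => //.
  apply: (sub_in_path (P := predC1 w') (e := r)) path2.
    move=> a b; rewrite !inE => aw bw /keep; apply; rewrite in_edge.
    by rewrite (negPf aw) (negPf bw) andbF.
  by apply/allP => a ap /=; apply: contraNneq w'_p2 => <-.
have con : connect r' w w'.
  apply: connect_trans con2 _; rewrite csym in con1.
  by rewrite csym; apply: connect_trans (connect1 r'uv); rewrite csym csym.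
apply: connect_sub => x y rxy.
have [|/(keep _ _ rxy)/connect1 //] := boolP ((x, y) \in edge w w').
by rewrite in_edge => /orP[]/andP[/eqP -> /eqP ->] //; rewrite csym.
Qed.

Section Improvement.
Variables (e : rel T) (k : nat) (E0 : {set T * T}).
Hypotheses (graph_e : simple_graph e) (tree0 : treelike E0).
Hypothesis (E0e : subrel (arc_rel E0) e).

Local Notation deg E x := (degree (arc_rel E) x).
Definition excess E := \sum_x (deg E x - k).
Local Notation con S E := (connect (arc_rel (avoid S E))).

(** Graphs obtained from E0 by changes inside the components of E0 - S.  The
    degree bound outside S makes the excess of a variant depend on S only, where
    the degrees are those of E0. *)
Definition variant S E :=
  [/\ symmetric (arc_rel E) /\ subrel (arc_rel E) e,
      forall x y, (x \in S) || (y \in S) -> arc_rel E x y = arc_rel E0 x y,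
      con S E =2 con S E0
    & forall x, x \notin S -> deg E x <= k].

Definition few_arcs E := #|E| + 2 <= 2 * #|T|.

(** Outside S', arcs touching S are shared, and those avoiding S can be
    replaced by walks that avoid S. *)
Lemma con_mono S S' E F : S' \subset S ->
  (forall x y, (x \in S) || (y \in S) -> arc_rel E x y = arc_rel F x y) ->
  subrel (con S E) (con S F) -> subrel (con S' E) (con S' F).
Proof.
move=> /subsetP S'S agree conEF; apply: connect_sub => x y.
rewrite in_avoid => /and3P[Exy xS' yS'].
have [xyS|] := boolP ((x \in S) || (y \in S)).
  by apply: connect1; rewrite in_avoid xS' yS' !andbT -agree.
rewrite negb_or => /andP[xS yS].
have : con S F x y by apply/conEF/connect1; rewrite in_avoid Exy xS.
apply: connect_sub => a b; rewrite in_avoid => /and3P[Fab aS bS].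
apply: connect1; rewrite in_avoid Fab.
by rewrite (contra (S'S a)) ?(contra (S'S b)).
Qed.

Lemma variant_mono S S' E : S' \subset S ->
  (forall x, x \notin S' -> deg E0 x <= k) -> variant S E -> variant S' E.
Proof.
move=> S'S deg0 [symsub agree conS degE].
split=> //.
- move=> x y xyS; apply: agree.
  by case/orP: xyS => /(subsetP S'S) ->; rewrite ?orbT.
- move=> x y; apply/idP/idP; apply: (con_mono S'S) => //.
  + by move=> a b; rewrite conS.
  + by move=> a b /agree.
  + by move=> a b; rewrite conS.
- move=> x xS'; have [xS|/degE //] := boolP (x \in S).
  suff -> : deg E x = deg E0 x by apply: deg0.
  by apply: eq_card => y; rewrite !inE agree ?xS.
Qed.

Lemma avoid0 E : avoid set0 E = E.
Proof. by apply/setP => p; rewrite !inE andbT. Qed.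

Lemma variant_loopless S E : variant S E -> loopless E.
Proof.
by case=> [[_ subE] _ _ _] x; apply/negP => /subE; rewrite (proj2 graph_e).
Qed.

Lemma variant_connected S E x y : variant S E -> connect (arc_rel E) x y.
Proof.
case=> [[symE subE] agree conS _]; have [_ _ con0 _] := tree0.
rewrite -[E]avoid0; apply: (con_mono (sub0set S) (E := E0));
  last by rewrite avoid0.
  by move=> a b /agree.
by move=> a b; rewrite conS.
Qed.

Lemma variant_self S : (forall x, x \notin S -> deg E0 x <= k) -> variant S E0.
Proof. by move=> deg0; split=> //; split=> //; case: tree0. Qed.

(** When C is a component of E0 - S and E, F are variants, this is E inside C
    and F elsewhere.  Selecting arcs by their source alone is enough, since
    arcs that leave C end in S, where the two graphs agree. *)
Definition mix (C : {set T}) E F : {set T * T} :=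
  [set p | if p.1 \in C then p \in E else p \in F].

Lemma arc_rel_mix C E F x y :
  arc_rel (mix C E F) x y = if x \in C then arc_rel E x y else arc_rel F x y.
Proof. by rewrite /arc_rel /= inE. Qed.

Lemma deg_mix C E F x :
  deg (mix C E F) x = if x \in C then deg E x else deg F x.
Proof.
rewrite /degree; case: ifP => xC; apply: eq_card => y;
  by rewrite !inE arc_rel_mix xC.
Qed.

Lemma card_mix C E F : #|mix C E F| + #|mix C F E| = #|E| + #|F|.
Proof.
have cardD (A : {set T * T}) :
    #|A| = #|[set p in A | p.1 \in C]| + #|[set p in A | p.1 \notin C]|.
  rewrite -(cardsID [set p | p.1 \in C] A); congr (_ + _);
    apply: eq_card => p; rewrite !inE //.
  by rewrite andbC.
have part A B : [set p in mix C A B | p.1 \in C] = [set p in A | p.1 \in C].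
  by apply/setP => p; rewrite !inE; case: (p.1 \in C); rewrite ?andbF.
have partN A B :
    [set p in mix C A B | p.1 \notin C] = [set p in B | p.1 \notin C].
  by apply/setP => p; rewrite !inE; case: (p.1 \in C); rewrite ?andbF.
rewrite (cardD (mix C E F)) (cardD (mix C F E)) !part !partN.
rewrite (cardD E) (cardD F).
lia.
Qed.

Section Mix.
Variables (S : {set T}) (u : T).
Hypothesis uS : u \notin S.
Let C := [set x | con S E0 u x].

Lemma class_closed E x y :
  variant S E -> arc_rel (avoid S E) x y -> (x \in C) = (y \in C).
Proof.
case=> [[symE _] _ conS _] Exy; rewrite !inE -!conS.
exact: (same_connect_r (sym_connect_sym (avoid_sym S symE)) (connect1 Exy)).
Qed.

Lemma variant_mix E F : variant S E -> variant S F -> variant S (mix C E F).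
Proof.
move=> vE vF; have [[symE subE] agE conE degE] := vE.
have [[symF subF] agF conF degF] := vF.
have agree x y : (x \in S) || (y \in S) ->
    arc_rel (mix C E F) x y = arc_rel E0 x y.
  by move=> xyS; rewrite arc_rel_mix; case: ifP => _; [apply: agE | apply: agF].
split=> //; first split.
- move=> x y.
  have [xyS|] := boolP ((x \in S) || (y \in S)).
    by rewrite !agree // 1?orbC //; case: tree0.
  rewrite negb_or => /andP[xS yS]; rewrite !arc_rel_mix.
  have avoidE G : arc_rel G x y = arc_rel (avoid S G) x y
    by rewrite in_avoid xS yS !andbT.
  have avoidE' G : arc_rel G y x = arc_rel (avoid S G) y x
    by rewrite in_avoid xS yS !andbT.
  case: ifP => xC; case: ifP => yC //.
  + rewrite avoidE avoidE'.
    apply/idP/idP => [/(class_closed vE)|/(class_closed vF)];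
      by rewrite xC yC.
  + rewrite avoidE avoidE'.
    apply/idP/idP => [/(class_closed vF)|/(class_closed vE)];
      by rewrite xC yC.
- move=> x y; rewrite arc_rel_mix.
  by case: ifP => _; [apply: subE | apply: subF].
- have mixO x y : arc_rel (avoid S (mix C E F)) x y
      = if x \in C then arc_rel (avoid S E) x y else arc_rel (avoid S F) x y.
    by rewrite !in_avoid arc_rel_mix; case: ifP.
  move=> x y; apply/idP/idP.
    apply: connect_sub => a b; rewrite mixO; case: ifP => _ /connect1.
      by rewrite conE.
    by rewrite conF.
  have [xC|xC] := boolP (x \in C).
    rewrite -conE; apply: (@connect_within C) => // a b aC Eab.
    by rewrite mixO aC Eab -(class_closed vE Eab).
  rewrite -conF; apply: (@connect_within (~: C)); rewrite ?in_setC //.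
  move=> a b; rewrite in_setC => aC Fab.
  by rewrite mixO (negPf aC) Fab in_setC -(class_closed vF Fab).
- by move=> x xS; rewrite deg_mix; case: ifP => _; [apply: degE | apply: degF].
Qed.

(** The two ways to mix E and F have together as many arcs as E and F, and
    either one, being connected, has at least those of a tree. *)
Lemma few_arcs_mix E F :
  variant S E -> variant S F -> few_arcs E -> few_arcs F ->
  few_arcs (mix C E F).
Proof.
move=> vE vF sE sF; have vM := variant_mix vF vE.
have [[symM _] _ _ _] := vM.
have := connected_card_ge u symM (variant_loopless vM)
          (fun x y => variant_connected x y vM).
by move: sE sF (card_mix C E F); rewrite /few_arcs; lia.
Qed.

(** Vertices in different components of E0 - S can be brought below degree k
    at the same time. *)
Lemma variant_combine v E F : ~~ con S E0 u v ->
  variant S E -> few_arcs E -> deg E u < k ->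
  variant S F -> few_arcs F -> deg F v < k ->
  exists G, [/\ variant S G, few_arcs G, deg G u < k & deg G v < k].
Proof.
move=> nuv vE sE dE vF sF dF; exists (mix C E F); split.
- exact: variant_mix.
- exact: few_arcs_mix.
- by rewrite deg_mix inE connect0.
- by rewrite deg_mix inE (negPf nuv).
Qed.

End Mix.

Definition exchange E u v w w' := (E :|: edge u v) :\: edge w w'.

Section Exchange.
Variables (S : {set T}) (E : {set T * T}) (u v : T).
Hypotheses (vE : variant S E) (sE : few_arcs E).
Hypotheses (uS : u \notin S) (vS : v \notin S) (e_uv : e u v).
Hypothesis n_uv : ~~ con S E0 u v.
Hypotheses (du : deg E u < k) (dv : deg E v < k).

Let symE : symmetric (arc_rel E). Proof. by case: vE => [[]]. Qed.

Lemma u_neq_v : u != v.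
Proof. by apply: contraTneq e_uv => ->; rewrite (proj2 graph_e). Qed.

Lemma exchange_sym w w' : symmetric (arc_rel (exchange E u v w w')).
Proof. exact: arcsD_sym (arcsU_sym symE (edge_sym u v)) (edge_sym w w'). Qed.

Lemma in_exchange w w' x y : arc_rel (exchange E u v w w') x y
  = ((x, y) \notin edge w w') && (arc_rel E x y || ((x, y) \in edge u v)).
Proof. by rewrite /arc_rel /exchange /= in_setD [_ \in E :|: _]in_setU. Qed.

Lemma exchange_sub w w' : subrel (arc_rel (exchange E u v w w')) e.
Proof.
have [[_ subE] _ _ _] := vE.
move=> x y; rewrite in_exchange => /andP[_ /orP[/subE //|]].
rewrite in_edge => /orP[]/andP[/eqP -> /eqP ->] //.
by rewrite (proj1 graph_e).
Qed.

Section Edge.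
Variables w w' : T.

Lemma deg_exchange x :
  x != u -> x != v -> deg (exchange E u v w w') x <= deg E x.
Proof.
move=> xu xv; apply: subset_leq_card; apply/subsetP => y.
rewrite !inE in_exchange [_ \in edge u v]in_edge.
by rewrite (negPf xu) (negPf xv) orbF => /andP[].
Qed.

Lemma deg_exchange_ends x : x \in [:: u; v] -> deg (exchange E u v w w') x <= k.
Proof.
rewrite !inE => uv_x.
have [z sub_z] : exists z, [set y | arc_rel (exchange E u v w w') x y]
    \subset z |: [set y | arc_rel E x y].
  exists (if x == u then v else u); apply/subsetP => y.
  rewrite !inE in_exchange [_ \in edge u v]in_edge.
  case/andP=> _ /orP[->|]; first by rewrite orbT.
  have nuv := u_neq_v.
  case/orP: uv_x => /eqP -> ;
    rewrite ?eqxx ?(negPf nuv) 1?eq_sym ?(negPf nuv) /= ?orbF.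
    by rewrite eq_sym => ->.
  by rewrite eq_sym => ->.
apply: leq_trans (subset_leq_card sub_z) _; rewrite cardsU1.
have : deg E x < k by case/orP: uv_x => /eqP ->.
by rewrite /degree; case: (_ \notin _); lia.
Qed.

Lemma deg_exchange_le x : deg E x <= k -> deg (exchange E u v w w') x <= k.
Proof.
move=> le_k; have [/deg_exchange_ends //|] := boolP (x \in [:: u; v]).
rewrite !inE negb_or => /andP[xu xv].
exact: leq_trans (deg_exchange xu xv) le_k.
Qed.

Hypotheses (wS : w \in S) (Eww' : arc_rel E w w').

Lemma exchange_few_arcs : few_arcs (exchange E u v w w').
Proof.
have ne_w : w != w'.
  by apply: contraTneq Eww' => ->; apply: (variant_loopless vE).
have sub : edge w w' \subset E :|: edge u v.
  apply/subsetP => p; rewrite !inE => /orP[]/eqP->.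
    by have := Eww'; rewrite /arc_rel /= => ->.
  by have := Eww'; rewrite symE /arc_rel /= => ->.
have [] := leq_card_setU E (edge u v); rewrite (card_edge u_neq_v) => le_U _.
have := subset_leq_card sub; rewrite card_edge // => ge_U.
move: sE; rewrite /few_arcs /exchange cardsD (setIidPr sub) card_edge //; lia.
Qed.

Lemma deg_exchange_lt : deg (exchange E u v w w') w < deg E w.
Proof.
apply: proper_card; apply/properP; split; last first.
  by exists w'; rewrite !inE // in_exchange in_edge !eqxx.
have wu : w != u by apply: contraTneq wS => ->.
have wv : w != v by apply: contraTneq wS => ->.
apply/subsetP => y.
rewrite !inE in_exchange [_ \in edge u v]in_edge.
by rewrite (negPf wu) (negPf wv) orbF => /andP[].
Qed.

(** Outside S the new graph has no excess; on S no degree grows and that of w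
    drops. *)
Lemma exchange_excess : k < deg E0 w ->
  excess (exchange E u v w w') < excess E0.
Proof.
move=> gt_k; have [_ agree _ degE] := vE.
have degS x : x \in S -> deg E x = deg E0 x.
  by move=> xS; apply: eq_card => y; rewrite !inE agree ?xS.
have le_x x : deg (exchange E u v w w') x - k <= deg E0 x - k.
  have [xS|xS] := boolP (x \in S); last first.
    by have := deg_exchange_le (degE _ xS); rewrite -subn_eq0 => /eqP ->.
  rewrite -degS //; apply: leq_sub2r; apply: deg_exchange.
    by apply: contraTneq xS => ->.
  by apply: contraTneq xS => ->.
rewrite /excess (bigD1 w) //= [ltnRHS](bigD1 w) //= -addSn leq_add //;
  last exact: leq_sum.
by have := deg_exchange_lt; rewrite (degS w wS); lia.
Qed.

End Edge.

(** The edge removed at w is the one by which the path arrives there.  The new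
    graph has the same components as E off any set S' that the path avoids,
    because the whole exchange takes place off S'. *)
Lemma exchange_on_path p w :
  path (arc_rel E) u p -> last u p = v -> uniq (u :: p) -> w \in p -> w \in S ->
  exists w', [/\ arc_rel E w w', w' \in u :: p &
    forall S', (forall x, x \in u :: p -> x \notin S') ->
      con S' (exchange E u v w w') =2 con S' E].
Proof.
move=> path_p last_p uniq_p /splitPr def_p wS.
case: p / def_p path_p last_p uniq_p => p1 p2 path_p last_p uniq_p.
exists (last u p1); split.
- by move: path_p; rewrite cat_path /= symE => /and3P[].
- by rewrite -cat_cons mem_cat mem_last.
move=> S' pS'; set F := exchange _ _ _ _ _.
have symOE := avoid_sym S' symE.
have symOF : symmetric (arc_rel (avoid S' F)).
  by apply: avoid_sym; apply: exchange_sym.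
have pathO : path (arc_rel (avoid S' E)) u (p1 ++ w :: p2).
  apply: (sub_in_path (P := [pred x | x \notin S'])) path_p; last by apply/allP.
  by move=> x y; rewrite !inE in_avoid => -> -> ->.
have uS' : u \notin S' by apply: pS'; rewrite mem_head.
have vS' : v \notin S' by apply: pS'; rewrite -last_p mem_last.
have Fuv : arc_rel (avoid S' F) u v.
  rewrite in_avoid uS' vS' !andbT in_exchange [_ \in edge u v]in_edge.
  rewrite !eqxx orbT andbT in_edge negb_or; apply/andP; split.
    by rewrite negb_and; apply/orP; left; apply: contraTneq wS => <-.
  by rewrite negb_and; apply/orP; right; apply: contraTneq wS => <-.
move=> x y; apply/idP/idP.
  apply: connect_sub => {x y} x y; rewrite in_avoid => /and3P[Fxy xS yS].
  move: Fxy; rewrite in_exchange => /andP[_ /orP[Exy|]].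
    by apply: connect1; rewrite in_avoid xS yS !andbT.
  have con_uv : con S' E u v by apply/connectP; exists (p1 ++ w :: p2).
  rewrite in_edge => /orP[]/andP[/eqP -> /eqP ->] //.
  by rewrite (sym_connect_sym symOE).
apply: (connect_exchange symOF pathO uniq_p _ Fuv).
  by rewrite -last_p last_cat.
move=> a b; rewrite !in_avoid => /and3P[Eab -> ->] nab; rewrite !andbT.
by rewrite in_exchange nab Eab.
Qed.

Lemma exchange_variant S' w w' : S' \subset S ->
  (forall x, x \notin S' -> deg E0 x <= k) ->
  w \notin S' -> w' \notin S' ->
  con S' (exchange E u v w w') =2 con S' E -> variant S' (exchange E u v w w').
Proof.
move=> S'S deg0 wS' w'S' conF.
have [_ agree conE degE] := variant_mono S'S deg0 vE.
split.
- by split; [apply: exchange_sym | apply: exchange_sub].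
- move=> x y xyS'; rewrite in_exchange !in_edge -agree //.
  have uS' : u \notin S' by apply: contra uS; apply: subsetP.
  have vS' : v \notin S' by apply: contra vS; apply: subsetP.
  have ne2 a b : a \notin S' -> b \notin S' ->
      (x == a) && (y == b) = false.
    move=> aS' bS'; apply/negP => /andP[/eqP xa /eqP yb].
    by move: xyS'; rewrite xa yb (negPf aS') (negPf bS').
  by rewrite !ne2 //= orbF.
- by move=> x y; rewrite conF conE.
- by move=> x /degE; apply: deg_exchange_le.
Qed.

End Exchange.

Lemma comps_le S E : comps E <= #|S| + #|rep E @: ~: S|.
Proof.
apply: leq_trans (leq_card_setU _ _).1.
apply: subset_leq_card; apply/subsetP => x; rewrite !inE => /eqP rx.
have [//|xS /=] := boolP (x \in S).
by rewrite -rx imset_f // inE.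
Qed.

Variable x0 : T.
Hypotheses (k_gt1 : 1 < k) (deg_x0 : k < deg E0 x0).
Hypothesis tough : forall (S : {set T}) (f : T -> T),
  (forall x y, x \notin S -> y \notin S -> e x y -> f x = f y) ->
  #|f @: ~: S| <= (k - 2) * #|S| + 1.

(** The induction on the size of S amounts to the choice of a minimal set S
    outside which all degrees can be brought below k. *)
Lemma improve_from S :
  (forall x, x \notin S -> deg E0 x <= k) ->
  (forall x, x \notin S ->
    exists E, [/\ variant S E, few_arcs E & deg E x < k]) ->
  exists E1, [/\ treelike E1, subrel (arc_rel E1) e & excess E1 < excess E0].
Proof.
have [m] := ubnP #|S|; elim: m S => // m IHm S lt_m deg0 reduce.
have [/existsP[x /and3P[xS dx le_x]]|high] :=
  boolP [exists x, [&& x \in S, deg E0 x < k & deg E0 x <= k]].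
  have SxS : S :\ x \subset S by apply: subD1set.
  have deg0' y : y \notin S :\ x -> deg E0 y <= k.
    by rewrite !inE negb_and negbK => /orP[/eqP ->|/deg0].
  apply: (IHm (S :\ x)) => //.
    by move: lt_m; rewrite (cardsD1 x S) xS; lia.
  move=> y; rewrite !inE negb_and negbK; have [-> _|_ /= yS] := eqVneq y x.
    by exists E0; split=> //; [apply: variant_self | case: tree0].
  have [E [vE sE dE]] := reduce y yS.
  by exists E; split=> //; apply: variant_mono vE.
have {}high x : x \in S -> k <= deg E0 x.
  move=> xS; rewrite leqNgt; apply: contra high => dx.
  by apply/existsP; exists x; rewrite xS dx ltnW.
have [/existsP[u /existsP[v /and4P[uS vS e_uv n_uv]]]|sep] :=
  boolP [exists u, exists v,
           [&& u \notin S, v \notin S, e u v & ~~ con S E0 u v]].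
  have [Eu [vEu sEu du]] := reduce u uS; have [Ev [vEv sEv dv]] := reduce v vS.
  have [E [vE sE {}du {}dv]] := variant_combine uS n_uv vEu sEu du vEv sEv dv.
  have /connectP[q path_q last_q] := variant_connected u v vE.
  case/shortenP: path_q last_q => p path_p uniq_p _ last_p.
  pose W := [set w in S | w \in p].
  have inW x : x \in u :: p -> x \notin S :\: W.
    rewrite !inE negb_and negbK => /orP[/eqP ->|->].
      by rewrite (negPf uS) orbT.
    by rewrite andbT; apply: orbN.
  (* W is the part of S on the cycle closed by the edge uv.  An exchange at a
     vertex of W of degree above k improves the tree; if there is none, the
     vertices of W can be dropped from S. *)
  have [/existsP[w /andP[]]|low] := boolP [exists w in W, k < deg E0 w].
    rewrite inE => /andP[wS wp] deg_w.
    have [w' [Eww' _ conF]] := exchange_on_path vE uS vS path_p (esym last_p)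
                               uniq_p wp wS.
    exists (exchange E u v w w'); split.
    - split.
      + exact: exchange_sym vE _ _.
      + move=> x; apply/negP => /(exchange_sub vE e_uv).
        by rewrite (proj2 graph_e).
      + move=> x y; rewrite -[exchange _ _ _ _ _]avoid0 conF ?avoid0.
          exact: variant_connected vE.
        by move=> z _; rewrite inE.
      + exact: (exchange_few_arcs vE sE uS vS).
    - by move=> x y; apply: (exchange_sub vE e_uv).
    - exact: (exchange_excess vE sE uS vS).
  have {}low w : w \in W -> deg E0 w <= k.
    move=> Ww; rewrite leqNgt; apply: contra low => dw.
    by apply/existsP; exists w; rewrite Ww.
  have S'S : S :\: W \subset S by apply: subsetDl.
  have deg0' x : x \notin S :\: W -> deg E0 x <= k.
    by rewrite inE negb_and negbK => /orP[/low|/deg0].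
  apply: (IHm (S :\: W)) => //.
    rewrite -ltnS; apply: leq_trans lt_m; rewrite ltnS; apply: proper_card.
    rewrite properEneq S'S andbT; apply/eqP => SW.
    (* W is not empty: the path from u to v must pass through S. *)
    case/negP: n_uv; have [_ _ <- _] := vE; apply/connectP; exists p => //.
    apply: (sub_in_path (P := [pred x | x \notin S])) path_p.
      by move=> a b; rewrite !inE in_avoid => -> -> ->.
    by apply/allP => x /inW; rewrite SW.
  move=> x; have [xW _|xW] := boolP (x \in W); last first.
    rewrite inE xW /= => xS; have [E' [vE' sE' dE']] := reduce x xS.
    by exists E'; split=> //; apply: variant_mono vE'.
  have := xW; rewrite inE => /andP[xS xp].
  have [w' [Exw' pw' conF]] := exchange_on_path vE uS vS path_p (esym last_p)
                               uniq_p xp xS.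
  exists (exchange E u v x w'); split.
  - apply: (exchange_variant vE) => //; last by apply: conF.
      by rewrite inE xW.
    exact: inW.
  - exact: (exchange_few_arcs vE sE uS vS).
  - have := deg_exchange_lt uS vS xS Exw'; move/leq_trans; apply.
    have [_ agree _ _] := vE.
    suff -> : deg E x = deg E0 x by apply: low.
    by apply: eq_card => y; rewrite !inE agree ?xS.
exfalso.
(* No edge of e joins two components of E0 - S: the components are counted. *)
have x0S : x0 \in S by apply: contraTT deg_x0 => /deg0; rewrite -leqNgt.
have nzS : S != set0 by apply/set0Pn; exists x0.
have symO : symmetric (arc_rel (avoid S E0)) by apply: avoid_sym; case: tree0.
have := tough (f := rep (avoid S E0)) _ => /(_ S) le_tough.
have {}le_tough :
    #|rep (avoid S E0) @: ~: S| <= (k - 2) * #|S| + 1.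
  apply: le_tough => x y xS yS e_xy.
  apply/(fingraph.rootP (sym_connect_sym symO)).
  apply: contraT => nxy; case/negP: sep; apply/existsP; exists x.
  by apply/existsP; exists y; rewrite xS yS e_xy.
have sum_ge : k * #|S| < \sum_(x in S) deg E0 x.
  rewrite (bigD1 x0) //= (cardsD1 x0) x0S mulnDr muln1 -addSn leq_add //.
  rewrite mulnC -sum_nat_const.
  have -> : \sum_(x in S :\ x0) k = \sum_(x in S | x != x0) k.
    by apply: eq_bigl => x; rewrite !inE andbC.
  by apply: leq_sum => x /andP[/high].
have := sum_degree_le tree0 nzS; have := comps_le S (avoid S E0).
move: le_tough sum_ge; nia.
Qed.

Lemma improve :
  exists E1, [/\ treelike E1, subrel (arc_rel E1) e & excess E1 < excess E0].
Proof. by apply: (@improve_from setT) => x; rewrite inE. Qed.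

End Improvement.

Theorem bounded_degree_spanning_tree (e : rel T) k :
  0 < #|T| -> 1 < k -> simple_graph e -> connected_graph e ->
  (forall (S : {set T}) (f : T -> T),
    (forall x y, x \notin S -> y \notin S -> e x y -> f x = f y) ->
    #|f @: ~: S| <= (k - 2) * #|S| + 1) ->
  exists t : rel T, spanning_tree e t /\ max_degree t <= k.
Proof.
move=> /card_gt0P[x0 _] k_gt1 graph_e con_e tough.
have [E treeE subE] := treelike_exists x0 graph_e con_e.
have [m] := ubnP (excess k E); elim: m E treeE subE => //.
move=> m IHm E treeE subE lt_m.
have [/existsP[x deg_x]|low] := boolP [exists x, k < degree (arc_rel E) x].
  have [F [treeF subF lt_F]] := improve graph_e treeE subE k_gt1 deg_x tough.
  by apply: (IHm F) => //; rewrite -ltnS; apply: leq_trans lt_m.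
exists (arc_rel E); split; first by split; [apply: treelike_tree | ].
apply/bigmax_leqP => x _; rewrite leqNgt; apply: contra low => dx.
by apply/existsP; exists x.
Qed.

End Forests.

(** * Rayleigh quotients over a real closed field *)
Local Open Scope ring_scope.

Lemma char_poly_conj (F : fieldType) n (P D : 'M[F]_n) :
  P \in unitmx -> char_poly (invmx P *m D *m P) = char_poly D.
Proof.
move=> Pu; pose Q := map_mx polyC P; pose Q' := map_mx polyC (invmx P).
have QQ : Q' *m Q = 1%:M by rewrite -map_mxM mulVmx // map_mx1.
rewrite /char_poly.
have -> : char_poly_mx (invmx P *m D *m P) = Q' *m char_poly_mx D *m Q.
  rewrite /char_poly_mx !map_mxM mulmxBr mulmxBl; congr (_ - _).
  by rewrite mul_mx_scalar -scalemxAl QQ scalemx1.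
by rewrite !det_mulmx mulrAC -det_mulmx QQ det1 mul1r.
Qed.

Section Rayleigh.
Local Open Scope sesquilinear_scope.

Variables (R : rcfType) (n : nat) (A : 'M[R]_n) (mu : seq R).
Hypotheses (symA : A^T = A) (spA : is_spectrum A mu).

Local Notation toC := (@real_complex R).
Local Notation "M ^C" := (map_mx toC M) : ring_scope.

Lemma conj_realmx m p (M : 'M[R]_(m, p)) : map_mx Num.conj M^C = M^C.
Proof. by apply/matrixP => i j; rewrite !mxE; apply: conjc_real. Qed.

Lemma conjtr_realmx m p (M : 'M[R]_(m, p)) : M^C^t* = M^T^C.
Proof. by apply/matrixP => i j; rewrite !mxE; apply: conjc_real. Qed.

(** A real symmetric matrix is Hermitian over R[i], where the spectral theorem
    applies; its eigenvalues are real. *)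
Lemma symmetric_diagonalization :
  exists (P : 'M[R[i]]_n) (d : 'rV[R]_n),
    [/\ P \is unitarymx, A^C = P^t* *m diag_mx d^C *m P
      & perm_eq mu [tuple d 0 i | i < n]].
Proof.
have hermA : A^C \is hermsymmx.
  by apply/is_hermitianmxP; rewrite expr0 scale1r map_trmx symA conj_realmx.
have /orthomx_spectralP defA := hermitian_normalmx hermA.
have Pu := spectral_unitarymx A^C.
have /mxOverP dR := hermitian_spectral_diag_real hermA.
pose d := map_mx (@complex.Re R) (spectral_diag A^C).
have dE : spectral_diag A^C = d^C.
  by apply/matrixP => i j; rewrite !mxE RRe_real.
exists (spectralmx A^C), d; rewrite -invmx_unitary // -dE; split=> //.
apply: (perm_map_inj (@complexI R)); apply: prod_XsubC_eq.
rewrite big_map -map_prod_XsubC -(proj2 spA) map_char_poly defA.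
rewrite char_poly_conj ?unitarymx_unit // char_poly_trig ?diag_mx_is_trig //.
rewrite big_map big_tuple; apply: eq_bigr => i _.
by rewrite tnth_map tnth_ord_tuple dE !mxE eqxx.
Qed.

Lemma diag_form (x : 'rV[R[i]]_n) (d : 'rV[R[i]]_n) :
  (x *m diag_mx d *m x^t*) 0 0 = \sum_i d 0 i * `|x 0 i| ^+ 2.
Proof.
rewrite mxE; apply: eq_bigr => i _.
by rewrite mul_mx_diag !mxE normCK mulrAC mulrC mulrA.
Qed.

Lemma diag1_form (x : 'rV[R[i]]_n) :
  (x *m x^t*) 0 0 = \sum_i `|x 0 i| ^+ 2.
Proof. by rewrite mxE; apply: eq_bigr => i _; rewrite !mxE normCK. Qed.

Lemma form_diagonalized (P : 'M[R[i]]_n) (d v : 'rV[R]_n) :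
  A^C = P^t* *m diag_mx d^C *m P ->
  ((v *m A *m v^T) 0 0)%:C%C
    = \sum_i (d 0 i)%:C%C * `|(v^C *m P^t*) 0 i| ^+ 2.
Proof.
move=> defA.
transitivity ((v *m A *m v^T)^C 0 0); first by rewrite [RHS]mxE.
rewrite !map_mxM defA !mulmxA.
have -> : v^C *m P^t* *m diag_mx d^C *m P *m (v^T)^C
    = v^C *m P^t* *m diag_mx d^C *m (v^C *m P^t*)^t*.
  by rewrite trmx_mul map_mxM trmxCK conjtr_realmx !mulmxA.
by rewrite diag_form; apply: eq_bigr => i _; rewrite [d^C 0 i]mxE.
Qed.

Lemma norm_diagonalized (P : 'M[R[i]]_n) (v : 'rV[R]_n) :
  P \is unitarymx ->
  ((v *m v^T) 0 0)%:C%C = \sum_i `|(v^C *m P^t*) 0 i| ^+ 2.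
Proof.
move=> Pu; transitivity ((v *m v^T)^C 0 0); first by rewrite [RHS]mxE.
rewrite -diag1_form trmx_mul [in RHS]map_mxM trmxCK conjtr_realmx mulmxA.
by rewrite -[_ *m P^t* *m P]mulmxA -invmx_unitary // mulVmx ?unitarymx_unit //
           mulmx1 map_mxM.
Qed.

Lemma size_spectrum : size mu = n.
Proof.
have := size_char_poly A; rewrite (proj2 spA).
by rewrite size_prod_XsubC => -[].
Qed.

Lemma spectrum_le_last z : z \in mu -> z <= mu`_n.-1.
Proof.
move=> mu_z; have lt_z : (index z mu < n)%N by rewrite -size_spectrum index_mem.
rewrite -{1}(nth_index 0 mu_z).
apply: (sorted_leq_nth le_trans le_refl 0 (proj1 spA));
  rewrite ?inE ?size_spectrum //.
  by case: (n) lt_z => // k _ /=.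
by rewrite -ltnS; case: (n) lt_z.
Qed.

Lemma rayleigh_le_max (v : 'rV[R]_n) :
  (v *m A *m v^T) 0 0 <= mu`_n.-1 * (v *m v^T) 0 0.
Proof.
have [P [d [Pu defA mu_d]]] := symmetric_diagonalization.
rewrite -lecR rmorphM /= (form_diagonalized v defA) (norm_diagonalized v Pu).
rewrite mulr_sumr; apply: ler_sum => i _; apply: ler_wpM2r.
  by rewrite exprn_ge0.
rewrite lecR spectrum_le_last // (perm_mem mu_d).
by apply/tnthP; exists i; rewrite tnth_map tnth_ord_tuple.
Qed.

(** The exception is an index that carries the smallest eigenvalue. *)
Lemma all_but_one_ge_second (d : 'rV[R]_n) :
  (0 < n)%N -> perm_eq mu [tuple d 0 i | i < n] ->
  exists i0, forall i, i != i0 -> mu`_1 <= d 0 i.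
Proof.
move=> n_gt0 /tuple_permP[s def_mu]; exists (s (Ordinal n_gt0)) => i.
rewrite -{1 2}(permKV s i); set j := (s^-1 i)%g => ne_j.
have j_gt0 : (0 < j)%N.
  rewrite lt0n; apply: contraNneq ne_j => j0; apply/eqP; congr (s _).
  exact: val_inj.
have -> : d 0 (s j) = mu`_j.
  by rewrite def_mu -tnth_nth !tnth_map !tnth_ord_tuple.
have lt1 : (1 < n)%N by apply: leq_ltn_trans j_gt0 (ltn_ord j).
by apply: (sorted_leq_nth le_trans le_refl 0 (proj1 spA));
  rewrite ?inE ?size_spectrum.
Qed.

(** If the second eigenvalue is positive, a kernel vector z has just one
    nonzero coordinate in an orthonormal eigenbasis, at the index of the
    smallest eigenvalue; the coordinate of v at that index then vanishes. *)
Lemma rayleigh_ge_second (v z : 'rV[R]_n) :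
  0 < mu`_1 -> z != 0 -> z *m A = 0 -> v *m z^T = 0 ->
  mu`_1 * (v *m v^T) 0 0 <= (v *m A *m v^T) 0 0.
Proof.
move=> mu2_gt0 nz_z zA vz.
have [P [d [Pu defA mu_d]]] := symmetric_diagonalization.
have n_gt0 : (0 < n)%N.
  have [i /negP _] := rV0Pn _ nz_z; exact: leq_ltn_trans (ltn_ord i).
have [i0 d_ge] := all_but_one_ge_second n_gt0 mu_d.
pose w (x : 'rV[R]_n) := x^C *m P^t*.
have dz i : (d 0 i)%:C%C * w z 0 i = 0.
  have : w z *m diag_mx d^C = 0.
    apply: (can_inj (mulmxK (unitarymx_unit Pu))).
    by rewrite mul0mx -!mulmxA [P^t* *m _]mulmxA -defA -map_mxM zA map_mx0.
  by move/rowP/(_ i); rewrite mul_mx_diag !mxE mulrC.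
have wz0 i : i != i0 -> w z 0 i = 0.
  move/d_ge => di; apply/eqP; have /eqP := dz i; rewrite mulf_eq0.
  case/orP=> // /eqP/complexI d0; by rewrite d0 leNgt mu2_gt0 in di.
have wz_nz : w z 0 i0 != 0.
  apply: contraNneq nz_z => wzi0; apply/eqP.
  have : w z = 0.
    by apply/rowP => i; rewrite [RHS]mxE; have [->|/wz0] := eqVneq i i0.
  move/(congr1 (mulmxr P)); rewrite /= mul0mx /w -mulmxA.
  rewrite -invmx_unitary // mulVmx ?unitarymx_unit // mulmx1.
  move/rowP=> z0; apply/rowP => i; apply: complexI; have := z0 i.
  by rewrite !mxE.
have wv0 : w v 0 i0 = 0.
  have : (w v *m (w z)^t*) 0 0 = 0.
    rewrite /w trmx_mul map_mxM trmxCK conjtr_realmx mulmxA.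
    rewrite -[_ *m P^t* *m P]mulmxA -invmx_unitary // mulVmx ?unitarymx_unit //.
    by rewrite mulmx1 -map_mxM vz !mxE.
  rewrite mxE (bigD1 i0) //= big1 ?addr0 => [|i ne_i]; last first.
    by rewrite [(w z)^t* i 0]mxE [(w z)^T i 0]mxE wz0 // conjC0 mulr0.
  rewrite [(w z)^t* i0 0]mxE [(w z)^T i0 0]mxE => /eqP.
  rewrite mulf_eq0 conjC_eq0 (negPf wz_nz) orbF.
  by move/eqP.
rewrite -lecR rmorphM /= (form_diagonalized v defA) (norm_diagonalized v Pu).
rewrite mulr_sumr; apply: ler_sum => i _.
have [->|ne_i] := eqVneq i i0.
  by rewrite -/(w v) wv0 normr0 expr0n !mulr0.
by apply: ler_wpM2r; [rewrite exprn_ge0 | rewrite lecR d_ge].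
Qed.

End Rayleigh.

(** * Edge cuts and Laplacian eigenvalues *)
Definition cut (T : finType) (e : rel T) (C : {set T}) : nat :=
  (\sum_(x in C) #|[set y | e x y & y \notin C]|)%N.

Section LaplacianForm.
Variables (R : rcfType) (T : finType) (e : rel T) (mu : seq R).
Hypothesis (sym_e : symmetric e).

Local Notation n := #|T|.
Local Notation L := (laplacian R e).

Definition vec_of (f : T -> R) : 'rV[R]_n := \row_i f (enum_val i).

Lemma sum_ord_enum (F : T -> R) : \sum_(i < n) F (enum_val i) = \sum_x F x.
Proof.
by rewrite [RHS](reindex (@enum_val T T)) //; apply/onW_bij/enum_val_bij.
Qed.

Lemma vec_ofM (f g : T -> R) :
  (vec_of f *m (vec_of g)^T) 0 0 = \sum_x f x * g x.
Proof. by rewrite mxE -sum_ord_enum; apply: eq_bigr => i _; rewrite !mxE. Qed.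

Lemma degreeE x : (degree e x)%:R = \sum_(y | e x y) 1 :> R.
Proof.
by rewrite /degree -sum1_card natr_sum; apply: eq_bigl => y; rewrite inE.
Qed.

Lemma laplacian_sym : L^T = L.
Proof.
apply/matrixP => i j; rewrite !mxE sym_e.
by have [->|ne] := eqVneq i j; rewrite // eq_sym (negPf ne).
Qed.

Lemma vec_of_laplacian f :
  vec_of f *m L = vec_of (fun x => \sum_(y | e x y) (f x - f y)).
Proof.
apply/rowP => j; rewrite mulmxBr [in LHS]mxE mul_mx_diag !mxE.
rewrite sumrB mulrC degreeE mulr_suml; congr (_ - _).
  by apply: eq_bigr => y _; rewrite mul1r.
rewrite [RHS]big_mkcond -sum_ord_enum; apply: eq_bigr => i _.
by rewrite !mxE sym_e; case: ifP; rewrite ?mulr1 ?mulr0.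
Qed.

Lemma laplacian_const : vec_of (fun=> 1) *m L = 0.
Proof.
rewrite vec_of_laplacian; apply/rowP => i; rewrite !mxE.
by apply: big1 => y _; rewrite subrr.
Qed.

Variable (C : {set T}).
(** The centred indicator of C, scaled by the number of vertices to avoid
    fractions. *)
Definition balanced x : R := n%:R * (x \in C)%:R - #|C|%:R.

Lemma sum_mem : \sum_x (x \in C)%:R = #|C|%:R :> R.
Proof.
rewrite -sum1_card natr_sum [RHS]big_mkcond; apply: eq_bigr => x _.
by case: (x \in C).
Qed.

Lemma sum_balanced : \sum_x balanced x = 0.
Proof.
by rewrite sumrB -mulr_sumr sum_mem sumr_const mulr_natl subrr.
Qed.

Lemma norm_balanced :
  (vec_of balanced *m (vec_of balanced)^T) 0 0
    = n%:R * (#|C| * (n - #|C|))%:R.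
Proof.
rewrite vec_ofM natrM natrB ?max_card //.
transitivity (\sum_x (n%:R * (x \in C)%:R * balanced x)).
  apply/eqP; rewrite -subr_eq0 -sumrB; apply/eqP.
  transitivity (- #|C|%:R * \sum_x balanced x);
    last by rewrite sum_balanced mulr0.
  by rewrite mulr_sumr; apply: eq_bigr => x _; rewrite /balanced; ring.
transitivity (\sum_x ((x \in C)%:R * (n%:R * (n%:R - #|C|%:R : R)))).
  apply: eq_bigr => x _; rewrite /balanced.
  by case: (x \in C); rewrite ?mulr1 ?mulr0 ?mul1r ?mul0r.
by rewrite -mulr_suml sum_mem; ring.
Qed.

Lemma form_balanced :
  (vec_of balanced *m L *m (vec_of balanced)^T) 0 0 = n%:R ^+ 2 * (cut e C)%:R.
Proof.
pose chi x : R := (x \in C)%:R.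
have vecB : vec_of balanced = n%:R *: vec_of chi - #|C|%:R *: vec_of (fun=> 1).
  by apply/rowP => i; rewrite !mxE mulr1.
have L1 : L *m (vec_of (fun=> 1))^T = 0.
  by rewrite -laplacian_sym -trmx_mul laplacian_const trmx0.
rewrite {1}vecB mulmxBl -!scalemxAl laplacian_const scaler0 subr0.
have -> : (vec_of balanced)^T
    = n%:R *: (vec_of chi)^T - #|C|%:R *: (vec_of (fun=> 1))^T.
  by rewrite vecB linearB !linearZ.
rewrite mulmxBr -!scalemxAr -!scalemxAl.
rewrite -[vec_of chi *m L *m (vec_of (fun=> 1))^T]mulmxA L1 mulmx0.
rewrite !scaler0 subr0 scalerA -expr2 mxE; congr (_ * _).
rewrite vec_of_laplacian vec_ofM /cut natr_sum [RHS]big_mkcond.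
apply: eq_bigr => x _; rewrite /chi; case: ifP => xC; last by rewrite mulr0.
rewrite mulr1 -sum1_card natr_sum big_mkcond [RHS]big_mkcond.
apply: eq_bigr => y _; rewrite inE; case: (e x y) => //=.
by case: (y \in C); rewrite ?subrr ?subr0.
Qed.

Hypothesis spL : is_spectrum L mu.

Lemma cut_le_max :
  n%:R * (cut e C)%:R <= mu`_n.-1 * (#|C| * (n - #|C|))%:R.
Proof.
have [n0|n_gt0] := posnP n.
  by rewrite (eqP (_ : #|C| == 0)%N) ?n0 ?mul0r ?mulr0 // -leqn0 -n0 max_card.
have := rayleigh_le_max laplacian_sym spL (vec_of balanced).
rewrite form_balanced norm_balanced mulrCA expr2 -mulrA ler_pM2l //.
by rewrite ltr0n.
Qed.

Lemma cut_ge_second : 0 < mu`_1 ->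
  mu`_1 * (#|C| * (n - #|C|))%:R <= n%:R * (cut e C)%:R.
Proof.
have [n0|n_gt0] := posnP n.
  by rewrite (eqP (_ : #|C| == 0)%N) ?n0 ?mul0r ?mulr0 // -leqn0 -n0 max_card.
move=> mu2_gt0; have nz1 : vec_of (fun=> 1) != 0.
  apply/eqP => /rowP/(_ (Ordinal n_gt0)); rewrite !mxE => /eqP.
  by rewrite oner_eq0.
have orth : vec_of balanced *m (vec_of (fun=> 1))^T = 0.
  apply/rowP => i; rewrite ord1 vec_ofM [RHS]mxE -[RHS]sum_balanced.
  by apply: eq_bigr => x _; rewrite mulr1.
have := rayleigh_ge_second laplacian_sym spL mu2_gt0 nz1 laplacian_const orth.
rewrite form_balanced norm_balanced mulrCA expr2 -mulrA ler_pM2l //.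
by rewrite ltr0n.
Qed.

End LaplacianForm.

(** * Components left by the deletion of a vertex set *)
Section Components.
Variables (R : rcfType) (k : nat) (T : finType) (e : rel T) (mu : seq R).
Hypotheses (k_gt1 : (1 < k)%N) (T_gt1 : (1 < #|T|)%N).
Hypotheses (graph_e : simple_graph e) (conn_e : connected_graph e).
Hypothesis spL : is_spectrum (laplacian R e) mu.
Hypothesis gap : mu`_(#|T|.-1) <= (k%:R - 1) * mu`_1.

Lemma connected_cut1_gt0 x : (0 < cut e [set x])%N.
Proof.
have [y ne_yx] : exists y, y != x.
  apply/existsP; rewrite -negb_forall; apply: contraL T_gt1 => /forallP all_x.
  rewrite -leqNgt; apply/card_le1_eqP => y z _ _.
  by rewrite (eqP (all_x y)) (eqP (all_x z)).
have /connectP[[|z p] /= e_p y_last] := conn_e x y.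
  by rewrite y_last eqxx in ne_yx.
have /andP[e_xz _] := e_p.
rewrite /cut big_set1 card_gt0; apply/set0Pn; exists z.
rewrite !inE e_xz; apply: contraTneq e_xz => ->.
by rewrite (proj2 graph_e).
Qed.

(** The cut at a single vertex is not empty, so the largest eigenvalue is
    positive, and the hypothesis on the spectrum passes this on to the second
    one. *)
Lemma second_eigenvalue_gt0 : 0 < mu`_1.
Proof.
have [x _] : exists x : T, x \in T by apply/card_gt0P/ltnW.
have := cut_le_max (proj1 graph_e) [set x] spL.
have c_gt0 := connected_cut1_gt0 x.
rewrite cards1 mul1n => le_cut.
have k_gt0 : 0 < k%:R - 1 :> R by rewrite subr_gt0 ltr1n.
suff : 0 < mu`_(#|T|.-1) by move/lt_le_trans/(_ gap); rewrite pmulr_rgt0.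
have : 0 < mu`_(#|T|.-1) * (#|T| - 1)%:R.
  apply: lt_le_trans le_cut.
  by rewrite -natrM ltr0n muln_gt0 c_gt0 ltnW.
by rewrite pmulr_lgt0 // ltr0n subn_gt0.
Qed.

(** The components of G - S enter through a labelling f of the vertices that
    is constant along edges off S: each of its fibres there is a union of
    components. *)
Variables (I : finType) (f : T -> I) (S : {set T}).
Hypothesis f_e : forall x y, x \notin S -> y \notin S -> e x y -> f x = f y.

Local Notation parts := (f @: ~: S).
Let part a := [set x in ~: S | f x == a].

Lemma sum_parts (F : T -> nat) :
  (\sum_(a in parts) \sum_(x in part a) F x = \sum_(x in ~: S) F x)%N.
Proof.
rewrite [RHS](partition_big_imset f) /=; apply: eq_bigr => a _.
by apply: eq_bigl => x; rewrite !inE.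
Qed.

Lemma sum_card_parts : (\sum_(a in parts) #|part a| = #|~: S|)%N.
Proof.
rewrite -[RHS]sum1_card -sum_parts.
by apply: eq_bigr => a _; rewrite sum1_card.
Qed.

Lemma sum_cut_parts : (\sum_(a in parts) cut e (part a) = cut e (~: S))%N.
Proof.
rewrite /cut -[RHS]sum_parts; apply: eq_bigr => a _; apply: eq_bigr => x.
rewrite inE => /andP[]; rewrite inE => xS /eqP fx; apply: eq_card => y.
rewrite !inE negb_and negbK; case: (boolP (e x y)) => //= e_xy.
by case: (boolP (y \in S)) => //= yS; rewrite -fx (f_e xS yS e_xy) eqxx.
Qed.

(** The complement of a part contains S and a vertex of each other part. *)
Lemma card_part a : a \in parts -> (#|S| + #|parts|.-1 <= #|T| - #|part a|)%N.
Proof.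
move=> parts_a; have := sum_card_parts; rewrite (bigD1 a) //=.
have : (#|parts|.-1 <= \sum_(b in parts | b != a) #|part b|)%N.
  have -> : (#|parts|.-1 = \sum_(b in parts | b != a) 1)%N.
    rewrite (cardD1 a) parts_a -sum1_card.
    by apply: eq_bigl => b; rewrite inE andbC.
  apply: leq_sum => b /andP[/imsetP[x xS ->] _].
  by apply/card_gt0P; exists x; rewrite inE xS eqxx.
by have := cardsC S => <- le_m <-; rewrite addnCA addKn leq_add2l.
Qed.

(** Each part satisfies the lower bound on its cut and their union the upper
    bound; by [sum_cut_parts] the cuts add up, as edges leaving a part end in
    S. *)
Lemma parts_bound : (#|parts| <= (k - 2) * #|S| + 1)%N.
Proof.
have [->|[x xS]] := set_0Vmem (~: S); first by rewrite imset0 cards0.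
have N_gt0 : (0 < #|~: S|)%N by apply/card_gt0P; exists x.
have c_gt0 : (0 < #|parts|)%N by apply/card_gt0P; exists (f x); apply: imset_f.
have mu2_gt0 := second_eigenvalue_gt0.
have: mu`_1 * (#|~: S| * (#|S| + #|parts|.-1))%:R
      <= mu`_(#|T|.-1) * (#|~: S| * #|S|)%:R.
  have -> : #|S| = (#|T| - #|~: S|)%N by have := cardsC S; lia.
  apply: le_trans (cut_le_max (proj1 graph_e) (~: S) spL).
  rewrite -sum_cut_parts -sum_card_parts big_distrl /= !natr_sum !mulr_sumr.
  apply: ler_sum => a parts_a.
  apply: le_trans (cut_ge_second (proj1 graph_e) (part a) spL mu2_gt0).
  rewrite ler_pM2l // ler_nat leq_mul2l; apply/orP; right.
  by rewrite sum_card_parts -{1}(cardsC S) addnK; apply: card_part.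
rewrite mulnC [(#|~: S| * _)%N]mulnC !natrM !mulrA ler_pM2r ?ltr0n // => le1.
have /(le_trans le1) : mu`_(#|T|.-1) * #|S|%:R <= (k%:R - 1) * mu`_1 * #|S|%:R.
  by apply: ler_wpM2r gap; rewrite ler0n.
rewrite [_ * mu`_1]mulrC -mulrA ler_pM2l // -(natrB _ (ltnW k_gt1)) -natrM.
rewrite ler_nat; nia.
Qed.
End Components.

Theorem theorem4p2 (R : rcfType) (k : nat) (T : finType) (e : rel T)
    (mu : seq R) :
  (3 <= k)%N ->
  (2 <= #|T|)%N ->
  simple_graph e ->
  connected_graph e ->
  is_spectrum (laplacian R e) mu ->
  mu`_(#|T|.-1) <= (k%:R - 1) * mu`_1 ->
  exists t : rel T, spanning_tree e t /\ (max_degree t <= k)%N.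
Proof.
move=> k_ge3 T_ge2 graph_e conn_e spL gap.
have k_gt1 : (1 < k)%N by apply: ltnW.
apply: bounded_degree_spanning_tree => //; first exact: ltnW.
by move=> S f f_e; apply: (parts_bound k_gt1 T_ge2 graph_e conn_e spL gap).
Qed.
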